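(* Let $R, S$ be finite posets, and suppose the following data and assumptions are given. (i) The pairwise different posets $Q_1, \ldots, Q_I \in \mathfrak{P}_r^c$ form the set $\mathfrak{E}^c(R)$, and the pairwise different posets $Q'_1, \ldots, Q'_J \in \mathfrak{P}_r^c$ form the set $\mathfrak{E}^c(S)$. (ii) $\nu_j \in \mathbb{N}_0$ for every $j \in \{1,\ldots,J\}$; $J^* := \{ j \in \{1,\ldots,J\} : \nu_j \geq 1 \}$; and for every $j \in J^*$, $\lambda_j : \{1,\ldots,\nu_j\} \to \{1,\ldots,I\}$ is a mapping. (iii) $\{1,\ldots,I\} = \bigcup_{j \in J^*} \lambda_j(\{1,\ldots,\nu_j\})$; and for every $i \in \{1,\ldots,I\}$, $r(i) := \# \{ j \in J^* : i \in \lambda_j(\{1,\ldots,\nu_j\}) \}$. (iv) For every $j \in J^*$ and $i \in \lambda_j(\{1,\ldots,\nu_j\})$, $q_j(i) := \# \lambda_j^{-1}(\{i\})$. (v) For every $j \in J^*$ there exists a distributor from $Q_{\lambda_j(1)}, \ldots, Q_{\lambda_j(\nu_j)}$ to $Q'_j$. If for all $j \in J^*$ $$\max \left\{ \frac{\# \mathrm{Emb}(Q_i, R)}{q_j(i) \cdot r(i) \cdot \# \mathrm{Aut}(Q_i)} \; : \; i \in \lambda_j(\{1,\ldots,\nu_j\}) \right\} \; \leq \; \frac{\# \mathrm{Emb}(Q'_j, S)}{\# \mathrm{Aut}(Q'_j)},$$ then $R \sqsubseteq_G S$.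
   Context: $\mathfrak{P}$ is the class of all finite posets and $\mathfrak{P}_r$ is a fixed representation system of the isomorphism classes in $\mathfrak{P}$. $\mathcal{H}(P,Q)$ is the set of order homomorphisms $\xi : P \to Q$ ($x \leq y \Rightarrow \xi(x) \leq \xi(y)$). $\xi$ is strict if $x<y \Rightarrow \xi(x)<\xi(y)$; $\mathcal{S}^o(P,Q)$ is the set of strict and surjective homomorphisms. $\mathrm{Emb}(P,Q)$ is the set of embeddings (homomorphisms with $\xi(x) \leq \xi(y) \Rightarrow x \leq y$), and $\mathrm{Aut}(P)$ the set of automorphisms of $P$. For $A \subseteq P$ and $x,y \in A$, $x$ and $y$ are connected in $A$ if there are $z_0, \ldots, z_L \in A$, $L \geq 0$, with $x = z_0$, $y = z_L$ and, for each $\ell = 1,\ldots,L$, $z_{\ell-1} < z_\ell$ or $z_{\ell-1} > z_\ell$. $\gamma_A(x)$ denotes the set of $y \in A$ connected with $x$ in $A$. A poset $P$ is connected if $\gamma_P(x) = P$ for some $x \in P$. $\mathfrak{P}^c$ is the class of connected finite posets and $\mathfrak{P}_r^c := \mathfrak{P}^c \cap \mathfrak{P}_r$. For a finite poset $T$, $\mathfrak{E}^c(T)$ is the set of all $E \in \mathfrak{P}_r^c$ which can be embedded in $T$. For finite posets $Q, Q'$, $\tau \in \mathcal{S}^o(Q,Q')$ and $P \in \mathfrak{P}^c$, put $\mathcal{T}_\tau(P,Q) := \{ \tau \circ \sigma : \sigma \in \mathcal{S}^o(P,Q) \} \subseteq \mathcal{S}^o(P,Q')$. $\tau$ is called distributing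 iff, for every $P \in \mathfrak{P}^c$, the mapping $\mathcal{S}^o(P,Q) \to \mathcal{T}_\tau(P,Q)$, $\sigma \mapsto \tau \circ \sigma$, is injective. For $Q' \in \mathfrak{P}_r$ and a finite sequence $Q_1, \ldots, Q_L \in \mathfrak{P}_r$ ($L \in \mathbb{N}_0$, repetitions allowed), a distributor from $Q_1,\ldots,Q_L$ to $Q'$ is a sequence $\tau_\ell \in \mathcal{S}^o(Q_\ell, Q')$, $\ell = 1,\ldots,L$, such that every $\tau_\ell$ is distributing and, for every $P \in \mathfrak{P}^c$, the sets $\mathcal{T}_{\tau_\ell}(P,Q_\ell)$, $\ell = 1,\ldots,L$, are pairwise disjoint. For a homomorphism $\xi$ defined on $P$ and $x \in P$, $G_\xi(x) := \gamma_{\xi^{-1}(\{\xi(x)\})}(x)$. A Hom-scheme from $R$ to $S$ is a family $\rho = (\rho_P)_{P \in \mathfrak{P}_r}$ of maps $\rho_P : \mathcal{H}(P,R) \to \mathcal{H}(P,S)$. It is strong if every $\rho_P$ is injective. It is a G-scheme if $G_{\rho_P(\xi)}(x) = G_\xi(x)$ for all $P \in \mathfrak{P}_r$, $\xi \in \mathcal{H}(P,R)$, $x \in P$. We write $R \sqsubseteq_G S$ iff a strong G-scheme from $R$ to $S$ exists. *)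

(* Defs.v *)
From mathcomp Require Import all_boot all_order all_algebra.
Set Implicit Arguments.
Unset Strict Implicit.
Unset Printing Implicit Defensive.

Local Open Scope order_scope.

(* A finite poset is a [finPOrderType] of arbitrary display; the empty poset is
   allowed.  Maps between finite posets are finite functions. *)

Section Homomorphisms.
Variables (dP dQ : Order.disp_t) (P : finPOrderType dP) (Q : finPOrderType dQ).

Definition homs : {set {ffun P -> Q}} :=
  [set f : {ffun P -> Q} | [forall x, forall y, (x <= y) ==> (f x <= f y)]].

Definition embs : {set {ffun P -> Q}} :=
  [set f in homs | [forall x, forall y, (f x <= f y) ==> (x <= y)]].

Definition onto (f : {ffun P -> Q}) : bool := [forall y, exists x, f x == y].

Definition strict_onto_homs : {set {ffun P -> Q}} :=
  [set f in homs | [forall x, forall y, (x < y) ==> (f x < f y)] & onto f].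

(* Embeddings are injective by antisymmetry, hence bijective when onto. *)
Definition isos : {set {ffun P -> Q}} := [set f in embs | onto f].

Definition isomorphic : bool := isos != set0.

Definition embeddable : bool := embs != set0.

End Homomorphisms.

Definition auts (d : Order.disp_t) (P : finPOrderType d) := isos P P.

Definition ffcomp (P Q Q' : finType) (tau : {ffun Q -> Q'})
    (sigma : {ffun P -> Q}) : {ffun P -> Q'} :=
  [ffun x => tau (sigma x)].

Section Connectivity.
Variables (d : Order.disp_t) (P : finPOrderType d).

Definition linked (A : {set P}) : rel P :=
  [rel x y | [&& x \in A, y \in A & (x < y) || (y < x)]].

(* Meaningful for x in A. *)
Definition component (A : {set P}) (x : P) : {set P} :=
  [set y in A | connect (linked A) x y].

Definition connected : bool := [exists x, component [set: P] x == [set: P]].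

Definition Gset (T : finType) (xi : {ffun P -> T}) (x : P) : {set P} :=
  component (xi @^-1: [set xi x]) x.

End Connectivity.

(* A representation system of the isomorphism classes of finite posets is given
   as a family [rep]; its members are referred to by their indices, so that
   distinct members have distinct indices. *)
Definition representation_system (d : Order.disp_t) (idx : Type)
    (rep : idx -> finPOrderType d) : Prop :=
  forall (d' : Order.disp_t) (P : finPOrderType d'),
    exists! k : idx, isomorphic P (rep k).

Section Distributors.
Variables (dQ dQ' : Order.disp_t) (Q' : finPOrderType dQ').

Definition composites (Q : finPOrderType dQ) (tau : {ffun Q -> Q'})
    (d : Order.disp_t) (P : finPOrderType d) : {set {ffun P -> Q'}} :=
  [set ffcomp tau sigma | sigma in strict_onto_homs P Q].

Definition distributing (Q : finPOrderType dQ) (tau : {ffun Q -> Q'}) : Prop :=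
  forall (d : Order.disp_t) (P : finPOrderType d), connected P ->
    {in strict_onto_homs P Q &, injective (@ffcomp P Q Q' tau)}.

Definition distributor (L : nat) (Q : 'I_L -> finPOrderType dQ)
    (tau : forall l, {ffun Q l -> Q'}) : Prop :=
  [/\ forall l, tau l \in strict_onto_homs (Q l) Q',
      forall l, distributing (tau l)
    & forall (d : Order.disp_t) (P : finPOrderType d), connected P ->
        forall l m, l != m ->
          [disjoint composites (tau l) P & composites (tau m) P]].

End Distributors.

Section HomSchemes.
Variables (d : Order.disp_t) (idx : Type) (rep : idx -> finPOrderType d).
Variables (dR dS : Order.disp_t).
Variables (R : finPOrderType dR) (S : finPOrderType dS).

Definition hom_scheme : Type :=
  forall k, {xi : {ffun rep k -> R} | xi \in homs (rep k) R} ->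
            {xi : {ffun rep k -> S} | xi \in homs (rep k) S}.

Definition strong (rho : hom_scheme) : Prop := forall k, injective (rho k).

Definition G_scheme (rho : hom_scheme) : Prop :=
  forall k xi x, Gset (val (rho k xi)) x = Gset (val xi) x.

Definition sqsubseteq_G : Prop :=
  exists rho : hom_scheme, strong rho /\ G_scheme rho.

End HomSchemes.

(* Main.v *)
Require Import Defs.
From HB Require Import structures.
From mathcomp Require Import all_boot all_order all_algebra.
From mathcomp Require Import ring.
Set Implicit Arguments.
Unset Strict Implicit.
Unset Printing Implicit Defensive.
Import Order.TTheory GRing.Theory Num.Theory.

(** The G-sets of a homomorphism [xi] from [P] partition [P] into connected
blocks, and [xi] is determined by that partition together with the map that it
induces on the blocks; this induced map strictly increases along any two
comparable points of different blocks.  A strong G-scheme therefore exists as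
soon as, for each partition [D], at least as many homomorphisms into [S] as
into [R] have the G-sets prescribed by [D].

This count is reduced to connected posets.  The homomorphisms with partition
[D] correspond to the maps on the blocks that strictly increase along a
relation ([card_G_class]).  For an arbitrary relation on a finite set such maps
are chosen independently on the connected components ([card_increasing]), and
on one component the relation can be replaced by the partial order that it
generates ([card_increasing_connected]).  It remains to see that a connected
poset [P] has at most as many strict homomorphisms to [R] as to [S].

The image of a strict homomorphism of a connected poset is connected, hence
isomorphic to exactly one [Q i].  Factoring through this [Q i] is possible in
[#|auts (Q i)|] ways, so the number of strict homomorphisms to [R] is the sum
over [i] of [s i * n i], where [s i] counts the strict surjections from [P]
onto [Q i] and [n i = #|embs (Q i) R| / #|auts (Q i)|] ([card_strict_homs]);
in the same way the number for [S] is the sum over [j] of [s' j * m j].  The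
maximum condition says [n i <= q j i * r i * m j].  Splitting [s i * n i] into
[r i] equal shares, one for each [j] whose distributor uses [Q i], bounds the
sum for [R] by the sum over [j] of [m j] times the sum over [l] of
[s (lam j l)], and the distributor for [j] embeds the strict surjections
counted by this inner sum disjointly into those onto [Q' j]
([sum_distributor]). *)

Local Open Scope order_scope.

(** * Injections from inequalities of cardinalities *)

Section Transfer.
Variables (X Y : finType) (A : {set X}) (B : {set Y}).
Hypothesis leAB : (#|A| <= #|B|)%N.

Lemma card_sig_le : (#|{: {x | x \in A}}| <= #|{: {y | y \in B}}|)%N.
Proof. by rewrite !card_sig. Qed.

(** An explicit injection, and not only its existence: a Hom-scheme needs one
for every member of an infinite family of posets, and with a formula no choice
principle is involved. *)
Definition transfer (u : {x | x \in A}) : {y | y \in B} :=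
  enum_val (widen_ord card_sig_le (enum_rank u)).

Lemma transfer_inj : injective transfer.
Proof.
by move=> u v /enum_val_inj/(congr1 val)/= /val_inj/enum_rank_inj.
Qed.

End Transfer.

(** * Maps that increase along a relation *)

Section Increasing.
Variables (T : finType) (e : rel T).

(** With the strict order of a poset as [e], these are the strict
homomorphisms.  Allowing any relation makes it possible to restrict to
components and to pass to blocks without building a poset each time. *)
Definition increasing (d : Order.disp_t) (X : finPOrderType d) :
    {set {ffun T -> X}} :=
  [set f : {ffun T -> X} | [forall x, forall y, e x y ==> (f x < f y)]].

Definition adjacent : rel T := [rel x y | e x y || e y x].

Lemma increasingP d (X : finPOrderType d) (f : {ffun T -> X}) :
  reflect (forall x y, e x y -> f x < f y) (f \in increasing X).
Proof.
rewrite inE; apply: (iffP forallP) => [f_inc x y | f_inc x].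
  by move/forallP: (f_inc x) => /(_ y) /implyP.
by apply/forallP=> y; apply/implyP/f_inc.
Qed.

Lemma adjacent_sym : symmetric adjacent.
Proof. by move=> x y; rewrite /adjacent /= orbC. Qed.

Lemma increasing_connect d (X : finPOrderType d) (f : {ffun T -> X}) x y :
  f \in increasing X -> connect e x y -> (x == y) || (f x < f y).
Proof.
move=> /increasingP f_inc /connectP[p]; elim: p x => [|z p IHp] x /=.
  by move=> _ ->; rewrite eqxx.
case/andP=> /f_inc f_xz /IHp{}IHp /IHp /predU1P[<-|/(lt_trans f_xz)->].
  by rewrite f_xz orbT.
by rewrite orbT.
Qed.

End Increasing.

Arguments increasingP {T e d X f}.

Lemma connected_intro (d : Order.disp_t) (P : finPOrderType d) (x : P) :
  (forall y, connect (adjacent <%O) x y) -> connected P.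
Proof.
move=> x_conn; apply/existsP; exists x; apply/eqP/setP=> y.
rewrite !inE -[RHS](x_conn y); apply: eq_connect => u v.
by rewrite /linked /adjacent /= !inE.
Qed.

Lemma connected_elim (d : Order.disp_t) (P : finPOrderType d) :
  connected P -> exists x : P, forall y, connect (adjacent <%O) x y.
Proof.
case/existsP=> x /eqP/setP x_conn; exists x => y.
have:= x_conn y; rewrite !inE; apply: etrans; apply: eq_connect => u v.
by rewrite /linked /adjacent /= !inE.
Qed.

(** * Homomorphisms with prescribed G-sets *)

Section Fibers.
Variables (d : Order.disp_t) (P : finPOrderType d).

Definition fiber_link (T : eqType) (xi : P -> T) : rel P :=
  [rel x y | (xi x == xi y) && ((x < y) || (y < x))].

Lemma fiber_link_sym (T : eqType) (xi : P -> T) : connect_sym (fiber_link xi).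
Proof.
apply: sym_connect_sym => x y.
by rewrite /fiber_link /= eq_sym orbC.
Qed.

Lemma in_Gset (T : finType) (xi : {ffun P -> T}) x y :
  (y \in Gset xi x) = connect (fiber_link xi) x y.
Proof.
rewrite /Gset; move: (erefl (xi x)); move: {1 3}(xi x) => c Ec.
apply/idP/idP.
  rewrite inE => /andP[_]; apply: connect_sub => u v /and3P[].
  rewrite !inE => /eqP Eu /eqP Ev uv; apply: connect1.
  by rewrite /fiber_link /= Eu Ev eqxx.
case/connectP=> p; elim: p x Ec => [|z p IHp] x Ec /=.
  by move=> _ ->; rewrite !inE Ec eqxx connect0.
case/andP=> /andP[/eqP Exz xz] pz Ey; have Ecz: c = xi z by rewrite -Exz.
have := IHp z Ecz pz Ey; rewrite !inE => /andP[-> /=]; apply: connect_trans.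
by apply: connect1; rewrite /linked /= !inE -Exz -Ec eqxx.
Qed.

(** G-sets only depend on which pairs of comparable points are identified. *)
Lemma eq_Gset (T T' : finType) (xi : {ffun P -> T}) (xi' : {ffun P -> T'}) :
    (forall x y, x < y -> (xi x == xi y) = (xi' x == xi' y)) ->
  Gset xi =1 Gset xi'.
Proof.
move=> Exi x; apply/setP=> y; rewrite !in_Gset; apply: eq_connect => u v.
rewrite /fiber_link /=; case: (boolP (u < v)) => [/Exi-> //| _] /=.
case: (boolP (v < u)) => [/Exi|]; last by rewrite !andbF.
by rewrite (eq_sym (xi v)) (eq_sym (xi' v)) => ->.
Qed.

Lemma Gset_eq (T : finType) (xi : {ffun P -> T}) x y :
  Gset xi x = Gset xi y -> xi x = xi y.
Proof.
move=> Exy; have: y \in Gset xi x by rewrite Exy in_Gset connect0.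
by rewrite !inE => /andP[/eqP].
Qed.

Lemma eq_Gset_lt (T : finType) (xi : {ffun P -> T}) x y :
  x < y -> (Gset xi x == Gset xi y) = (xi x == xi y).
Proof.
move=> ltxy; apply/eqP/eqP=> [/Gset_eq // | Exy].
apply/setP=> z; rewrite !in_Gset; apply: same_connect (@fiber_link_sym _ _) _ _ _ _.
by apply: connect1; rewrite /fiber_link /= Exy eqxx ltxy.
Qed.

(** The partition into G-sets is recorded by the map [D] that sends each point
to its block. *)
Definition G_class (D : {ffun P -> {set P}}) (dX : Order.disp_t)
    (X : finPOrderType dX) : {set {ffun P -> X}} :=
  [set xi in homs P X | [forall x, Gset xi x == D x]].

End Fibers.

Lemma homsP (dP dX : Order.disp_t) (P : finPOrderType dP)
    (X : finPOrderType dX) (f : {ffun P -> X}) :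
  reflect {homo f : x y / x <= y} (f \in homs P X).
Proof.
rewrite inE; apply: (iffP forallP) => [f_hom x y | f_hom x].
  by move/forallP: (f_hom x) => /(_ y) /implyP.
by apply/forallP=> y; apply/implyP/f_hom.
Qed.
Arguments homsP {dP dX P X f}.

Lemma G_classP (d dX : Order.disp_t) (P : finPOrderType d)
    (X : finPOrderType dX) (D : {ffun P -> {set P}}) (xi : {ffun P -> X}) :
  reflect (xi \in homs P X /\ Gset xi =1 D) (xi \in G_class D X).
Proof.
apply: (iffP setIdP) => -[xi_hom xiD]; split=> //.
  by move=> x; apply/eqP; move/forallP: xiD.
by apply/forallP=> x; rewrite xiD.
Qed.
Arguments G_classP {d dX P X D xi}.

(** * Reduction to strict homomorphisms of connected posets *)

Section Reduction.
Variables (dR dS : Order.disp_t) (R : finPOrderType dR) (S : finPOrderType dS).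

Hypothesis card_strict : forall (d : Order.disp_t) (P : finPOrderType d),
  connected P ->
  (#|increasing (<%O : rel P) R| <= #|increasing (<%O : rel P) S|)%N.

(** A relation that admits an increasing map is acyclic, so its reflexive and
transitive closure is a partial order on [T]; the strict homomorphisms of this
poset are the maps increasing along [e]. *)
Lemma card_increasing_connected (T : finType) (e : rel T) (x0 : T) :
  (forall y, connect (adjacent e) x0 y) ->
  (#|increasing e R| <= #|increasing e S|)%N.
Proof.
(* Destructuring the finite type makes it convertible to the one underlying the
   poset [P] built on it below. *)
case: T e x0 => T [cC cE cQ cF]; set T' := Finite.Pack _ => e x0.
move=> x0_conn; have [->|[f0 f0_inc]] := set_0Vmem (increasing e R).
  by rewrite cards0.
have e_acyclic x y : e x y -> ~~ connect e y x.
  move=> exy; apply/negP=> /(increasing_connect f0_inc).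
  have f0_xy := increasingP f0_inc _ _ exy.
  case/predU1P=> [Eyx|/(lt_trans f0_xy)]; last by rewrite ltxx.
  by rewrite Eyx ltxx in f0_xy.
have le_anti : antisymmetric (connect e).
  move=> x y /andP[/(increasing_connect f0_inc)]; case: eqP => //= _ f0_xy.
  move/(increasing_connect f0_inc); case: eqP => //= _ /(lt_trans f0_xy).
  by rewrite ltxx.
pose m := Order.Le_isPOrder.Build dR T' (@connect0 T' e) le_anti
  (@connect_trans T' e).
pose P : finPOrderType dR := HB.pack T' m.
have ltE (x y : P) : (x < y) = (x != y) && connect e x y.
  by rewrite lt_neqAle.
have e_lt (x y : P) : e x y -> x < y.
  move=> exy; rewrite ltE connect1 // andbT; apply/eqP=> Exy.
  by have:= e_acyclic _ _ exy; rewrite Exy connect0.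
have incE d (X : finPOrderType d) :
    increasing (<%O : rel P) X = increasing e X.
  apply/setP=> f; apply/increasingP/idP=> [f_inc | f_inc x y].
    by apply/increasingP=> x y /e_lt; apply: f_inc.
  rewrite ltE => /andP[/negPf nexy /(increasing_connect f_inc)].
  by rewrite nexy.
rewrite -!incE; apply: (@card_strict _ P); apply: (@connected_intro _ P x0) => y.
apply: connect_sub (x0_conn y) => u v uv.
by apply: connect1; apply/orP; case/orP: uv => /e_lt; [left | right].
Qed.

(** An increasing map is the same as an independent choice of an increasing map
on each connected component, so injections for the components can be glued. *)
Lemma card_increasing (T : finType) (e : rel T) :
  (#|increasing e R| <= #|increasing e S|)%N.
Proof.
pose a := adjacent e.
have a_sym : connect_sym a by apply/sym_connect_sym/adjacent_sym.
(* Components are indexed by all points [c]; the type is empty unless [c] is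
   the chosen representative of its component. *)
pose comp (c : T) := {x : T | fingraph.root a x == c}.
pose ec (c : T) : rel (comp c) := relpre val e.
have rootE x y : e x y -> fingraph.root a x = fingraph.root a y.
  by move=> exy; apply/eqP; rewrite root_connect //; apply/connect1/orP; left.
have comp_conn c (x y : comp c) : connect (adjacent (@ec c)) x y.
  have: connect a (val x) (val y).
    by rewrite -root_connect // (eqP (valP x)) (eqP (valP y)).
  case/connectP=> p; elim: p x => [|z p IHp] x /=.
    by move=> _ /val_inj->; apply: connect0.
  case/andP=> axz pz Ey.
  have zP: fingraph.root a z == c.
    rewrite -(eqP (valP x)) eq_sym; apply/eqP.
    by case/orP: axz => /rootE.
  apply: connect_trans (IHp (exist _ z zP) pz Ey).
  exact: connect1.
pose F d (X : finPOrderType d) c := {f | f \in increasing (@ec c) X}.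
have /fin_all_exists[phi phi_inj] :
    forall c, exists phi : F _ R c -> F _ S c, injective phi.
  move=> c; suffices le_c :
      (#|increasing (@ec c) R| <= #|increasing (@ec c) S|)%N.
    by exists (transfer le_c); apply: transfer_inj.
  case: (pickP {: comp c}) => [x _ | c0].
    exact: (card_increasing_connected (comp_conn c x)).
  have incT d (X : finPOrderType d) : increasing (@ec c) X = setT.
    by apply/setP=> f; rewrite in_setT; apply/increasingP=> x; have:= c0 x.
  by rewrite !incT !cardsT !card_ffun (eq_card0 c0).
pose pt x : comp _ :=
  exist (fun y => fingraph.root a y == _) x (eqxx (fingraph.root a x)).
pose restr c (f : {ffun T -> R}) : {ffun comp c -> R} := [ffun x => f (val x)].
have restrP c (f : {f | f \in increasing e R}) :
    restr c (val f) \in increasing (@ec c) R.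
  apply/increasingP=> x y exy; rewrite !ffunE.
  exact: (increasingP (valP f)).
pose part c f : F _ R c := exist (fun g => g \in _) _ (restrP c f).
pose Phi (f : {f | f \in increasing e R}) : {ffun T -> S} :=
  [ffun x => val (phi (fingraph.root a x) (part _ f))
               (pt x)].
have PhiE f c (x : comp c) :
    Phi f (val x) = val (phi c (part _ f)) x.
  case: x => x xc; rewrite ffunE /=; have Ec := eqP xc.
  by case: c / Ec xc => xc; congr (fun_of_fin _ _); apply: val_inj.
have Phi_inc f : Phi f \in increasing e S.
  apply/increasingP=> x y exy; set c := fingraph.root a y.
  have xc: fingraph.root a x == c by rewrite (rootE _ _ exy).
  rewrite (PhiE f c (exist _ x xc)) (PhiE f c (pt y)).
  exact: (increasingP (valP (phi c _))).
have Phi_inj : injective Phi.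
  move=> f g Efg; apply: val_inj; apply/ffunP=> x.
  have /phi_inj/(congr1 val)/= :
      phi _ (part (fingraph.root a x) f) = phi _ (part _ g).
    by apply: val_inj; apply/ffunP=> y; rewrite -!PhiE Efg.
  by move/ffunP/(_ (pt x)); rewrite !ffunE.
rewrite -(card_sig (mem (increasing e R))) -(card_imset _ Phi_inj).
by apply/subset_leq_card/subsetP=> _ /imsetP[f _ ->].
Qed.

(** Homomorphisms with G-sets [D] correspond to the maps on the blocks of [D]
that increase along [e], where [e b c] means that the different blocks [b] and
[c] contain points [x <= y].  Every homomorphism with these G-sets induces such
a map because comparable points with equal values share a block.  Conversely
such a map composed with [x |-> D x] has G-sets [D] as soon as some
homomorphism [xi0] does: both identify the same comparable pairs. *)
Lemma card_G_class (d : Order.disp_t) (P : finPOrderType d)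
    (D : {ffun P -> {set P}}) :
  (#|G_class D R| <= #|G_class D S|)%N.
Proof.
have [->|[xi0 /G_classP[xi0_hom xi0D]]] := set_0Vmem (G_class D R).
  by rewrite cards0.
pose B := {b | b \in codom D}.
pose blk x : B := exist (fun b => b \in _) (D x) (codom_f D x).
pose mem_of (b : B) : P := iinv (valP b).
have mem_ofK b : blk (mem_of b) = b by apply: val_inj; apply: f_iinv.
pose e : rel B := fun b c =>
  (b != c) && [exists x, exists y, [&& blk x == b, blk y == c & x <= y]].
have eP x y : x <= y -> D x != D y -> e (blk x) (blk y).
  move=> lexy Dxy; rewrite /e -val_eqE Dxy /=.
  by apply/existsP; exists x; apply/existsP; exists y; rewrite !eqxx.
have to_quo : exists2 h : {ffun P -> R} -> {ffun B -> R},
      {in G_class D R &, injective h}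
    & {in G_class D R, forall xi, h xi \in increasing e R}.
  exists (fun xi => [ffun b => xi (mem_of b)]) => [xi xi'|xi].
    move=> /G_classP[_ xiD] /G_classP[_ xi'D] Exi; apply/ffunP=> x.
    have Dx: D (mem_of (blk x)) = D x by apply: (congr1 val (mem_ofK (blk x))).
    have /Gset_eq <-: Gset xi (mem_of (blk x)) = Gset xi x by rewrite !xiD.
    have /Gset_eq <-: Gset xi' (mem_of (blk x)) = Gset xi' x by rewrite !xi'D.
    by move/ffunP/(_ (blk x)): Exi; rewrite !ffunE.
  case/G_classP=> /homsP xi_hom xiD; apply/increasingP=> b c /andP[neqbc].
  case/existsP=> x /existsP[y /and3P[/eqP Eb /eqP Ec lexy]]; rewrite !ffunE.
  have Exi z : xi (mem_of (blk z)) = xi z.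
    by apply: Gset_eq; rewrite !xiD; apply: (congr1 val (mem_ofK (blk z))).
  have Dxy: D x != D y by move: neqbc; rewrite -Eb -Ec -val_eqE.
  rewrite -Eb -Ec !Exi lt_neqAle xi_hom // andbT -eq_Gset_lt ?xiD //.
  by rewrite lt_neqAle lexy andbT; apply: contraNneq Dxy => ->.
have from_quo : exists2 h : {ffun B -> S} -> {ffun P -> S},
    injective h & {in increasing e S, forall eta, h eta \in G_class D S}.
  exists (fun eta => [ffun x => eta (blk x)]) => [eta eta' Eeta|eta].
    by apply/ffunP=> b; move/ffunP/(_ (mem_of b)): Eeta; rewrite !ffunE mem_ofK.
  move/increasingP=> eta_inc.
  have EDxy x y : D x = D y -> eta (blk x) = eta (blk y).
    by move=> Dxy; congr (eta _); apply: val_inj.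
  have ltDxy x y : x <= y -> D x != D y -> eta (blk x) < eta (blk y).
    by move=> lexy /(eP _ _ lexy)/eta_inc.
  apply/G_classP; split.
    apply/homsP=> x y lexy; rewrite !ffunE.
    by have [/EDxy->//|/(ltDxy _ _ lexy)/ltW] := eqVneq (D x) (D y).
  move=> x; rewrite -xi0D; apply: eq_Gset => {}x y ltxy.
  rewrite -(eq_Gset_lt xi0) // !xi0D !ffunE.
  have [/EDxy->|/(ltDxy _ _ (ltW ltxy))] := eqVneq (D x) (D y).
    exact: eqxx.
  by rewrite lt_neqAle => /andP[/negPf].
case: to_quo from_quo => h h_inj hP [h' h'_inj h'P].
rewrite -(card_in_imset h_inj).
apply: leq_trans (_ : #|increasing e R| <= _)%N.
  by apply/subset_leq_card/subsetP=> _ /imsetP[xi /hP ? ->].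
apply: leq_trans (card_increasing e) _; rewrite -(card_imset _ h'_inj).
by apply/subset_leq_card/subsetP=> _ /imsetP[eta /h'P ? ->].
Qed.

(** A homomorphism is moved inside its own class, that is, from the maps to [R]
with G-sets [D] to the maps to [S] with G-sets [D]; since its image has the same
class, injectivity on each class is enough. *)
Lemma sqsubseteq_G_of_card (d : Order.disp_t) (idx : Type)
  (rep : idx -> finPOrderType d) : sqsubseteq_G rep R S.
Proof.
pose cls k (xi : {xi : {ffun rep k -> R} | xi \in homs (rep k) R}) :
  {ffun rep k -> {set rep k}} := [ffun x => Gset (val xi) x].
have clsP k xi : val xi \in G_class (@cls k xi) R.
  by apply/G_classP; split=> [|x]; [apply: valP | rewrite ffunE].
pose img k xi := transfer (card_G_class (@cls k xi))
  (exist (fun f => f \in _) _ (clsP k xi)).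
have imgP k xi : val (img k xi) \in homs (rep k) S.
  by have /G_classP[] := valP (img k xi).
have imgG k xi : Gset (val (img k xi)) =1 Gset (val xi).
  by move=> x; have /G_classP[_ ->] := valP (img k xi); rewrite ffunE.
exists (fun k xi => exist (fun f => f \in _) _ (imgP k xi)).
split=> [k xi xi'|k xi x]; last exact: imgG.
move=> /(congr1 val)/= Eimg; have Ecls: cls k xi = cls k xi'.
  by apply/ffunP=> x; rewrite !ffunE -(imgG k xi) -(imgG k xi') [val _]Eimg.
move: Eimg; rewrite /img; move: (clsP k xi) (clsP k xi'); rewrite -Ecls.
by move=> u u' /val_inj/transfer_inj/(congr1 val)/= /val_inj.
Qed.

End Reduction.

(** * Factoring strict homomorphisms through their images *)

Section Maps.
Variables (dP dQ : Order.disp_t) (P : finPOrderType dP) (Q : finPOrderType dQ).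

Lemma embsP (f : {ffun P -> Q}) :
  reflect {mono f : x y / x <= y} (f \in embs P Q).
Proof.
rewrite inE.
apply: (iffP andP) => [[/homsP f_hom /forallP f_emb] x y|f_mono].
  apply/idP/idP; last exact: f_hom.
  by move/forallP: (f_emb x) => /(_ y) /implyP.
split; first by apply/homsP=> x y; rewrite f_mono.
by apply/forallP=> x; apply/forallP=> y; rewrite f_mono; apply/implyP.
Qed.

Lemma ontoP (f : {ffun P -> Q}) :
  reflect (forall y, exists x, f x = y) (onto f).
Proof.
apply: (iffP forallP) => f_onto y.
  by have /existsP[x /eqP] := f_onto y; exists x.
by have [x <-] := f_onto y; apply/existsP; exists x.
Qed.

Lemma isosP (f : {ffun P -> Q}) :
  reflect ({mono f : x y / x <= y} /\ forall y, exists x, f x = y)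
          (f \in isos P Q).
Proof.
by rewrite inE; apply: (iffP andP) => -[/embsP f_mono /ontoP f_onto].
Qed.

Lemma strict_onto_homsP (f : {ffun P -> Q}) :
  reflect (f \in increasing <%O Q /\ forall y, exists x, f x = y)
          (f \in strict_onto_homs P Q).
Proof.
apply: (iffP setIdP).
  by case=> _ /andP[f_inc /ontoP f_onto]; rewrite inE.
case=> f_inc /ontoP f_onto.
split; last by rewrite inE in f_inc; rewrite f_inc.
apply/homsP=> x y; rewrite le_eqVlt => /predU1P[-> //|].
by move/(increasingP f_inc)/ltW.
Qed.

End Maps.

Arguments embsP {dP dQ P Q f}.
Arguments isosP {dP dQ P Q f}.
Arguments strict_onto_homsP {dP dQ P Q f}.

Lemma connected_image (dP dQ : Order.disp_t) (P : finPOrderType dP)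
    (Q : finPOrderType dQ) (f : {ffun P -> Q}) :
  f \in strict_onto_homs P Q -> connected P -> connected Q.
Proof.
case/strict_onto_homsP=> /increasingP f_inc f_onto /connected_elim[x x_conn].
apply: (@connected_intro _ Q (f x)) => q; have [y <-] := f_onto q.
case/connectP: (x_conn y) => p p_path ->; elim: p x {x_conn} p_path => //= z p IHp x.
case/andP=> xz /IHp; apply: connect_trans; apply: connect1.
by apply/orP; case/orP: xz => /f_inc; [left | right].
Qed.

Lemma ffcomp_lift (T Q X : finType) (eps : {ffun Q -> X}) (g : {ffun T -> X}) :
  g @: T \subset eps @: Q -> exists h : {ffun T -> Q}, ffcomp eps h = g.
Proof.
move/subsetP=> sub; have /fin_all_exists[h hE]: forall x, exists q, eps q = g x.
  by move=> x; have /imsetP[q _ ->] := sub _ (imset_f g (isT : x \in T)); exists q.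
by exists [ffun x => h x]; apply/ffunP=> x; rewrite !ffunE.
Qed.

Section ImageType.
Variables (dP dX : Order.disp_t) (P : finPOrderType dP) (X : finPOrderType dX).

Definition strict_onto_copy (d : Order.disp_t) (Q : finPOrderType d) :
    {set {ffun P -> X}} :=
  [set f in increasing <%O X | [exists eps in embs Q X, f @: P == eps @: Q]].

Lemma isos_of_eq_image (d d' : Order.disp_t) (Q : finPOrderType d)
    (Q' : finPOrderType d') eps eps' :
    eps \in embs Q X -> eps' \in embs Q' X -> eps @: Q = eps' @: Q' ->
  exists2 h, h \in isos Q Q' & eps = ffcomp eps' h.
Proof.
move=> /embsP eps_mono /embsP eps'_mono Eim.
have [h hE] : exists h, ffcomp eps' h = eps by apply: ffcomp_lift; rewrite Eim.
exists h; last by rewrite hE.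
have hxE x : eps' (h x) = eps x by rewrite -hE ffunE.
apply/isosP; split=> [x y|y]; first by rewrite -eps'_mono !hxE.
have /imsetP[x _ Ex]: eps' y \in eps @: Q by rewrite Eim imset_f.
by exists x; apply: (inc_inj eps'_mono); rewrite hxE.
Qed.

(** Fix one embedding [eps] of [Q] onto the image of [f].  In a factorization
[f = eps' o sigma] the embedding [eps'] has the same image as [eps], so it is
[eps] composed with an automorphism of [Q], which is arbitrary; and [eps']
determines [sigma]. *)
Lemma card_factorizations (d : Order.disp_t) (Q : finPOrderType d) f :
    f \in strict_onto_copy Q ->
  #|[set p in setX (strict_onto_homs P Q) (embs Q X) | ffcomp p.2 p.1 == f]|
    = #|auts Q|.
Proof.
rewrite inE => /andP[/increasingP f_inc /existsP[eps /andP[eps_emb /eqP Eim]]].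
have eps_inj := inc_inj (embsP eps_emb).
set D := [set p in _ | _].
have DP p : p \in D -> [/\ p.1 \in strict_onto_homs P Q, p.2 \in embs Q X
                         & ffcomp p.2 p.1 = f].
  by case: p => s e /setIdP[/setXP[? ?] /eqP].
have snd_inj : {in D &, injective snd}.
  move=> [s1 e1] [s2 e2] /DP[/= _ /embsP e1_emb E1] /DP[/= _ _ E2] /= E12.
  congr (_, _) => //; apply/ffunP=> x; apply: (inc_inj e1_emb).
  by rewrite {2}E12; move/ffunP/(_ x): E1; rewrite -E2 !ffunE.
have comp_inj : injective (@ffcomp Q Q X eps).
  move=> a b Eab; apply/ffunP=> x; apply: eps_inj.
  by move/ffunP/(_ x): Eab; rewrite !ffunE.
rewrite -(card_in_imset snd_inj) -(card_imset _ comp_inj).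
apply: eq_card; apply/subset_eqP/andP; split; apply/subsetP=> e.
  case/imsetP=> -[s e'] /DP[/= /strict_onto_homsP[_ s_onto] e_emb Ef] /= ->.
  suff Eim' : e' @: Q = eps @: Q.
    have [h h_iso ->] := isos_of_eq_image e_emb eps_emb Eim'.
    by apply: imset_f.
  rewrite -Eim -Ef; apply/setP=> x; apply/imsetP/imsetP=> -[q _ ->].
    by have [p <-] := s_onto q; exists p; rewrite ?ffunE.
  by exists (s q); rewrite ?ffunE.
case/imsetP=> a /isosP[a_mono a_onto] ->.
have Eim' : ffcomp eps a @: Q = f @: P.
  rewrite Eim; apply/setP=> x; apply/imsetP/imsetP=> -[q _ ->].
    by exists (a q); rewrite ?ffunE.
  by have [p <-] := a_onto q; exists p; rewrite ?ffunE.
have ea_mono : {mono ffcomp eps a : x y / x <= y}.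
  by move=> x y; rewrite !ffunE (embsP eps_emb) a_mono.
have [s sE] : exists s, ffcomp (ffcomp eps a) s = f.
  by apply: ffcomp_lift; rewrite Eim'.
apply/imsetP; exists (s, ffcomp eps a) => //.
rewrite inE in_setX /= sE eqxx andbT; apply/andP; split; last exact/embsP.
apply/strict_onto_homsP; split.
  apply/increasingP=> x y /f_inc; rewrite -(leW_mono ea_mono).
  by rewrite -sE [X in X < _]ffunE [X in _ < X]ffunE.
move=> q; have /imsetP[x _ Ex]: ffcomp eps a q \in f @: P by rewrite -Eim' imset_f.
by exists x; apply: (inc_inj ea_mono); rewrite Ex -sE [RHS]ffunE.
Qed.

Lemma card_strict_onto_copy (d : Order.disp_t) (Q : finPOrderType d) :
  (#|strict_onto_homs P Q| * #|embs Q X| = #|strict_onto_copy Q| * #|auts Q|)%N.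
Proof.
rewrite -cardsX -sum1_card.
rewrite (partition_big (fun p => ffcomp p.2 p.1) (mem (strict_onto_copy Q))) /=.
  rewrite -sum_nat_const; apply: eq_bigr => f /card_factorizations <-.
  by rewrite -sum1_card; apply: eq_bigl => p; rewrite inE.
move=> [s e] /setXP[/= /strict_onto_homsP[/increasingP s_inc s_onto] e_emb].
rewrite inE; apply/andP; split.
  by apply/increasingP=> x y /s_inc; rewrite !ffunE (leW_mono (embsP e_emb)).
apply/existsP; exists e; rewrite e_emb /=; apply/eqP/setP=> x.
apply/imsetP/imsetP=> -[q _ ->]; first by exists (s q); rewrite ?ffunE.
by have [p <-] := s_onto q; exists p; rewrite ?ffunE.
Qed.

Lemma auts_gt0 (d : Order.disp_t) (Q : finPOrderType d) : (0 < #|auts Q|)%N.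
Proof.
apply/card_gt0P; exists [ffun x => x]; apply/isosP.
by split=> [x y|y]; [rewrite !ffunE | exists y; rewrite ffunE].
Qed.

Section Enumeration.
Variables (d : Order.disp_t) (idx : Type) (rep : idx -> finPOrderType d).
Hypothesis rep_sys : representation_system rep.
Variables (n : nat) (Q : 'I_n -> idx).
Hypothesis Q_inj : injective Q.
Hypothesis Q_E :
  forall k, (exists i, Q i = k) <-> connected (rep k) && embeddable (rep k) X.
Hypothesis P_conn : connected P.

(** The image of [f], as a poset in its own right, is the image of the connected
poset [P] under a strict map, and its representative is therefore one of the
[Q i]. *)
Lemma strict_onto_copy_exists f :
  f \in increasing <%O X -> exists i, f \in strict_onto_copy (rep (Q i)).
Proof.
move=> f_inc; pose Y : finPOrderType dX :=
  HB.pack {x | x \in f @: P} [POrder of {x | x \in f @: P} by <:].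
have val_mono : {mono (val : Y -> X) : x y / x <= y} by [].
have [k [isoYk _]] := rep_sys Y.
have /set0Pn[g /isosP[g_mono g_onto]] := isoYk.
have /fin_all_exists[h hK] := g_onto.
pose eps : {ffun rep k -> X} := [ffun q => val (h q)].
have eps_emb : eps \in embs (rep k) X.
  by apply/embsP=> x y; rewrite !ffunE val_mono -g_mono !hK.
pose fY (x : P) : Y := exist (fun y => y \in _) (f x) (imset_f f (isT : x \in P)).
have Eim : f @: P = eps @: rep k.
  apply/setP=> x; apply/imsetP/imsetP=> -[y _ ->].
    exists (g (fY y)) => //; rewrite ffunE.
    by rewrite (inc_inj g_mono (hK (g (fY y)))).
  by rewrite ffunE; have /imsetP[z _ ->] := valP (h y); exists z.
have sig : [ffun x => g (fY x)] \in strict_onto_homs P (rep k).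
  apply/strict_onto_homsP; split.
    apply/increasingP=> x y /(increasingP f_inc); rewrite !ffunE.
    by rewrite (leW_mono g_mono) -(leW_mono val_mono).
  move=> q; have /imsetP[x _ Ex] := valP (h q); exists x.
  by rewrite ffunE -[RHS]hK; congr (g _); apply: val_inj.
have [|i Ei] := (Q_E k).2.
  rewrite (connected_image sig P_conn); apply/set0Pn; by exists eps.
exists i; rewrite Ei inE f_inc; apply/existsP; exists eps.
by rewrite eps_emb Eim /=.
Qed.

Lemma strict_onto_copy_unique f i i' :
    f \in strict_onto_copy (rep (Q i)) -> f \in strict_onto_copy (rep (Q i')) ->
  i = i'.
Proof.
rewrite !inE => /andP[_ /existsP[e /andP[e_emb /eqP->]]].
case/andP=> _ /existsP[e' /andP[e'_emb /eqP Eim]].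
have [h h_iso _] := isos_of_eq_image e_emb e'_emb Eim.
have [k [_ k_unique]] := rep_sys (rep (Q i)).
apply: Q_inj; rewrite -(k_unique (Q i)); first apply: k_unique.
  by apply/set0Pn; exists h.
by rewrite /isomorphic -card_gt0 auts_gt0.
Qed.

(** Strict homomorphisms are sorted by the isomorphism type of their image. *)
Lemma card_strict_homs :
  (#|increasing (<%O : rel P) X|%:R =
    \sum_(i < n) #|strict_onto_homs P (rep (Q i))|%:R *
      (#|embs (rep (Q i)) X|%:R / #|auts (rep (Q i))|%:R) :> rat)%R.
Proof.
transitivity ((\sum_(i < n) #|strict_onto_copy (rep (Q i))|)%N%:R : rat)%R.
  congr (_%:R)%R; rewrite -sum1_card.
  transitivity (\sum_(i < n) \sum_(f in increasing (<%O : rel P) X)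
                  (f \in strict_onto_copy (rep (Q i))))%N.
    rewrite exchange_big /=; apply: eq_bigr => f f_inc.
    have [i fi] := strict_onto_copy_exists f_inc.
    rewrite (bigD1 i) //= fi big1 // => i' nei'.
    case: (boolP (f \in _)) => // /strict_onto_copy_unique/(_ fi)/eqP.
    by rewrite (negPf nei').
  apply: eq_bigr => i _; rewrite -big_mkcondr -sum1_card /=; apply: eq_bigl => f.
  by apply/andP/idP=> [[] //|fi]; split=> //; case/setIdP: fi.
rewrite natr_sum; apply: eq_bigr => i _.
have aut0 : (#|auts (rep (Q i))|%:R != 0 :> rat)%R.
  by rewrite pnatr_eq0 -lt0n auts_gt0.
by rewrite mulrA -natrM card_strict_onto_copy natrM mulfK.
Qed.

End Enumeration.
End ImageType.

(** * Counting with distributors *)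

(** Composition with each [tau l] is injective and the sets of composites are
disjoint, so the strict surjections onto the [Q l] together embed into those
onto [Q']. *)
Lemma sum_distributor (dQ dQ' dP : Order.disp_t) (Q' : finPOrderType dQ')
    (L : nat) (Q : 'I_L -> finPOrderType dQ) (tau : forall l, {ffun Q l -> Q'})
    (P : finPOrderType dP) :
  distributor tau -> connected P ->
  (\sum_(l < L) #|strict_onto_homs P (Q l)| <= #|strict_onto_homs P Q'|)%N.
Proof.
case=> tau_so tau_inj tau_disj P_conn.
have comp_sub l : composites (tau l) P \subset strict_onto_homs P Q'.
  have /strict_onto_homsP[/increasingP tau_inc tau_onto] := tau_so l.
  apply/subsetP=> _ /imsetP[s /strict_onto_homsP[/increasingP s_inc s_onto] ->].
  apply/strict_onto_homsP; split=> [|y].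
    by apply/increasingP=> u v /s_inc/tau_inc; rewrite !ffunE.
  by have [q <-] := tau_onto y; have [x <-] := s_onto q; exists x; rewrite ffunE.
have -> : (\sum_l #|strict_onto_homs P (Q l)| =
    \sum_l \sum_(g in strict_onto_homs P Q') (g \in composites (tau l) P))%N.
  apply: eq_bigr => l _; rewrite -(card_in_imset (tau_inj l _ P P_conn)).
  rewrite -big_mkcondr -sum1_card /=; apply: eq_bigl => g.
  by apply/idP/andP=> [gl|[] //]; split=> //; apply: (subsetP (comp_sub l)).
rewrite exchange_big /= -sum1_card; apply: leq_sum => g _.
case: (pickP (fun l => g \in composites (tau l) P)) => [l gl|no_l].
  rewrite (bigD1 l) //= gl big1 // => m neml.
  have := tau_disj _ P P_conn m l neml.
  by move/disjointFl->.
by rewrite big1 // => l _; rewrite no_l.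
Qed.

Local Close Scope order_scope.
Local Open Scope ring_scope.

Theorem theorem2
  (d : Order.disp_t) (idx : Type) (rep : idx -> finPOrderType d)
  (Hrep : representation_system rep)
  (dR dS : Order.disp_t) (R : finPOrderType dR) (S : finPOrderType dS)
  (* (i) *)
  (nI nJ : nat) (Q : 'I_nI -> idx) (Q' : 'I_nJ -> idx)
  (Q_inj : injective Q)
  (Q_E : forall k, (exists i, Q i = k) <-> connected (rep k) && embeddable (rep k) R)
  (Q'_inj : injective Q')
  (Q'_E : forall k, (exists j, Q' j = k) <-> connected (rep k) && embeddable (rep k) S)
  (* (ii) *)
  (nu : 'I_nJ -> nat)
  (Jstar : {set 'I_nJ}) (HJstar : Jstar = [set j | (1 <= nu j)%N])
  (lam : forall j : 'I_nJ, 'I_(nu j) -> 'I_nI)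
  (* (iii) *)
  (Hcover : [set: 'I_nI] = \bigcup_(j in Jstar) [set lam j l | l : 'I_(nu j)])
  (r : 'I_nI -> nat)
  (Hr : forall i, r i = #|[set j in Jstar | i \in [set lam j l | l : 'I_(nu j)]]|)
  (* (iv) *)
  (q : 'I_nJ -> 'I_nI -> nat)
  (Hq : forall j, j \in Jstar -> forall i, i \in [set lam j l | l : 'I_(nu j)] ->
          q j i = #|[set l : 'I_(nu j) | lam j l == i]|)
  (* (v) *)
  (Hdistr : forall j, j \in Jstar ->
     exists tau : forall l : 'I_(nu j), {ffun rep (Q (lam j l)) -> rep (Q' j)},
       distributor tau)
  (Hmax : forall j, j \in Jstar ->
     \big[Num.max/0]_(i in [set lam j l | l : 'I_(nu j)])
        (#|embs (rep (Q i)) R|%:R / (q j i * r i * #|auts (rep (Q i))|)%N%:R : rat)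
     <= #|embs (rep (Q' j)) S|%:R / #|auts (rep (Q' j))|%:R) :
  sqsubseteq_G rep R S.
Proof.
apply: sqsubseteq_G_of_card => dP P P_conn; rewrite -(ler_nat rat).
rewrite (card_strict_homs Hrep Q_inj Q_E P_conn).
rewrite (card_strict_homs Hrep Q'_inj Q'_E P_conn).
pose s i : rat := #|strict_onto_homs P (rep (Q i))|%:R.
pose m j : rat := #|embs (rep (Q' j)) S|%:R / #|auts (rep (Q' j))|%:R.
pose img j := [set lam j l | l : 'I_(nu j)].
(* The contribution of [Q i] is divided into [r i] equal shares, one for each
   [j] whose distributor uses [Q i]. *)
have bound i : s i * (#|embs (rep (Q i)) R|%:R / #|auts (rep (Q i))|%:R)
    <= \sum_(j in Jstar | i \in img j) s i * (q j i)%:R * m j.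
  set n_i := _ / _.
  have r_gt0 : (0 < (r i)%:R :> rat).
    rewrite ltr0n Hr card_gt0; apply/set0Pn.
    have := in_setT i; rewrite Hcover => /bigcupP[j jJ ij].
    by exists j; rewrite inE jJ.
  have n_le j : j \in Jstar -> i \in img j -> n_i / (r i)%:R <= (q j i)%:R * m j.
    move=> jJ ij; have q_gt0 : (0 < (q j i)%:R :> rat).
      rewrite ltr0n (Hq _ jJ _ ij) card_gt0; apply/set0Pn.
      by case/imsetP: ij => l _ ->; exists l; rewrite inE.
    rewrite [leRHS]mulrC -ler_pdivrMr //.
    apply: le_trans (Hmax _ jJ); apply: le_trans (le_bigmax_cond _ _ ij).
    rewrite le_eqVlt; apply/orP; left; apply/eqP.
    rewrite /n_i !natrM !invfM; ring.
  have -> : s i * n_i = \sum_(j in Jstar | i \in img j) s i * (n_i / (r i)%:R).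
    rewrite sumr_const.
    have -> : #|[pred j | (j \in Jstar) && (i \in img j)]| = r i.
      by rewrite Hr; apply: eq_card => j; rewrite !inE.
    by rewrite -[RHS]mulr_natr -mulrA divfK ?gt_eqF.
  apply: ler_sum => j /andP[jJ ij]; rewrite -mulrA.
  by apply: ler_wpM2l (n_le j jJ ij); apply: ler0n.
apply: le_trans (ler_sum _ (fun i _ => bound i)) _.
rewrite (exchange_big_dep (mem Jstar)) /= => [|i j _ /andP[] //].
rewrite [leRHS](bigID (mem Jstar)) /= -[leLHS]addr0; apply: lerD; last first.
  by apply: sumr_ge0 => j _; rewrite !mulr_ge0 ?invr_ge0 ?ler0n.
apply: ler_sum => j jJ; rewrite -mulr_suml; apply: ler_wpM2r.
  by rewrite mulr_ge0 ?invr_ge0 ?ler0n.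
have [tau tau_distr] := Hdistr _ jJ.
apply: (@le_trans _ _
    (\sum_(l < nu j) #|strict_onto_homs P (rep (Q (lam j l)))|)%N%:R);
  last first.
  by rewrite ler_nat (sum_distributor tau_distr P_conn).
(* Grouping the [l] by the value of [lam j l] makes [q j i] copies of [s i]. *)
rewrite (partition_big (lam j) (mem (img j))) /= => [|l _]; last exact: imset_f.
rewrite natr_sum; under eq_bigl do rewrite jJ; apply: ler_sum => i /= ij.
rewrite (Hq _ jJ _ ij) -natrM ler_nat mulnC -sum_nat_const.
by apply/eq_leq/eq_big => l; rewrite inE // => /eqP->.
Qed.
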